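(* Let $T\ge 1$, $u\ge 1$ and $\Delta$ be integers with $\frac{T+1}{2}\le\Delta\le T$. Consider the Embedded-Random Linear Code of rate $R=\frac12$ with shift $\Delta$ over $\mathbb{F}_q$, whose coefficient matrices have entries drawn independently and uniformly at random from $\mathbb{F}_q$. Then, with probability tending to $1$ as $q\to\infty$ (with $u,T,\Delta$ fixed), its column span and column distance are $$c_T=\Delta+1,\qquad d_T=T-\Delta+2,$$ so that $c_T+d_T=T+3$. This meets with equality the upper bound $c_T+d_T\le T+3$ satisfied by every time-invariant linear convolutional code of rate $\frac12$; hence these codes attain the optimal column-distance and column-span tradeoff at rate $\frac12$.
   Context: Time-invariant linear convolutional code over $\mathbb{F}_q$: given matrices $\mathbf{A}_0,\dots,\mathbf{A}_m\in\mathbb{F}_q^{k\times n}$, source packets $\mathbf{s}[i]\in\mathbb{F}_q^k$ (row vectors, $i\ge0$, zero for $i<0$) are mapped to channel packets $\mathbf{x}[i]=\sum_{j=0}^m\mathbf{s}[i-j]\mathbf{A}_j\in\mathbb{F}_q^n$; the rate is $k/n$. Column distance and span: for source packets $\mathbf{s}[0],\dots,\mathbf{s}[T]$ let $[\mathbf{x}[0],\dots,\mathbf{x}[T]]$ be the corresponding first $T+1$ channel packets. Its weight is the number of time indices in $\{0,\dots,T\}$ at which the channel packet is nonzero; its span is $j-i+1$, where $i$ and $j$ are the first and last time indices at which the channel packet is nonzero (and $0$ if all channel packets are zero). The column distance $d_T$ (resp. column span $c_T$) is the minimum of the weight (resp. span) over all $\mathbf{s}[0],\dots,\mathbf{s}[T]$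 with $\mathbf{s}[0]\neq0$. Embedded-Random Linear Code with parameters $(u,v,T,\Delta)$ ($u\ge1$, $v\ge0$): $\mathbf{s}[i]=(\mathbf{u}[i],\mathbf{v}[i])$ with $\mathbf{u}[i]\in\mathbb{F}_q^u$, $\mathbf{v}[i]\in\mathbb{F}_q^v$ (zero at negative times). Given matrices $\mathbf{G}_1,\dots,\mathbf{G}_{T-1}\in\mathbb{F}_q^{v\times u}$ and $\mathbf{H}_0,\dots,\mathbf{H}_{T-\Delta}\in\mathbb{F}_q^{u\times u}$, put $\mathbf{p}_v[i]=\sum_{j=1}^{T-1}\mathbf{v}[i-j]\mathbf{G}_j$ and $\mathbf{p}_u[i]=\sum_{j=0}^{T-\Delta}\mathbf{u}[i-j]\mathbf{H}_j$; the channel packet is $\mathbf{x}[i]=(\mathbf{u}[i],\mathbf{v}[i],\mathbf{p}_v[i]+\mathbf{p}_u[i-\Delta])\in\mathbb{F}_q^{2u+v}$. The rate is $R=\frac{u+v}{2u+v}$, so $R=\frac12$ corresponds to $v=0$, in which case $\mathbf{s}[i]=\mathbf{u}[i]$ and $\mathbf{x}[i]=(\mathbf{u}[i],\mathbf{p}_u[i-\Delta])$. All entries of the matrices are independent and uniform on $\mathbb{F}_q$. *)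

(* Defs.v *)
From HB Require Import structures.
From mathcomp Require Import all_boot all_order all_algebra.

Set Implicit Arguments.
Unset Strict Implicit.
Unset Printing Implicit Defensive.

Import Order.TTheory GRing.Theory Num.Theory.
Local Open Scope ring_scope.

(* [delay j x i] is x[i - j], where x vanishes at negative times. *)
Definition delay (V : nmodType) (j : nat) (x : nat -> V) (i : nat) : V :=
  if (j <= i)%N then x (i - j)%N else 0.

(* An encoder maps the source packets s[0], s[1], ... to the channel packets
   x[0], x[1], ... *)
Definition encoder (F : finFieldType) (k n : nat) : Type :=
  (nat -> 'rV[F]_k) -> nat -> 'rV[F]_n.

Definition rate (k n : nat) : rat := k%:R / n%:R.

(* The time-invariant linear convolutional code with matrices A_0, ..., A_m. *)
Definition conv_encoder (F : finFieldType) (k n m : nat)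
    (A : 'I_m.+1 -> 'M[F]_(k, n)) : encoder F k n :=
  fun s i => \sum_(j < m.+1) delay j s i *m A j.

Definition is_conv_encoder (F : finFieldType) (k n : nat)
    (enc : encoder F k n) : Prop :=
  exists (m : nat) (A : 'I_m.+1 -> 'M[F]_(k, n)),
    forall s i, enc s i = conv_encoder A s i.

(* Increasing list of the times in {0, ..., T} at which x is nonzero. *)
Definition support_times (V : nmodType) (T : nat) (x : nat -> V) : seq nat :=
  [seq i <- iota 0 T.+1 | x i != 0].

Definition weight (V : nmodType) (T : nat) (x : nat -> V) : nat :=
  size (support_times T x).

Definition span (V : nmodType) (T : nat) (x : nat -> V) : nat :=
  if support_times T x is i :: r then (last i r - i).+1 else 0%N.

(* The encoders considered are causal, so the values of the source after
   time T do not affect the first T + 1 channel packets; they are set to 0. *)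
Definition extend (V : nmodType) (T : nat) (s : {ffun 'I_T.+1 -> V}) :
    nat -> V :=
  fun i => if insub i is Some j then s j else 0.

(* Weights and spans never exceed T + 1, so the default value T + 1 of the
   iterated minimum is neutral as soon as some s[0] != 0 exists (k > 0). *)
Definition column_distance (F : finFieldType) (k n : nat)
    (enc : encoder F k n) (T : nat) : nat :=
  \big[minn/T.+1]_(s : {ffun 'I_T.+1 -> 'rV[F]_k} | s ord0 != 0)
     weight T (enc (extend s)).

Definition column_span (F : finFieldType) (k n : nat)
    (enc : encoder F k n) (T : nat) : nat :=
  \big[minn/T.+1]_(s : {ffun 'I_T.+1 -> 'rV[F]_k} | s ord0 != 0)
     span T (enc (extend s)).

(* The coefficients (G_1, ..., G_(T-1)) and (H_0, ..., H_(T-D)) of an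
   Embedded-Random Linear Code; G_j is stored at index j - 1. *)
Definition erlc_coefs (F : finFieldType) (u v T D : nat) : finType :=
  ({ffun 'I_T.-1 -> 'M[F]_(v, u)} * {ffun 'I_(T - D).+1 -> 'M[F]_u})%type.

Section ERLC.
Variables (F : finFieldType) (u v T D : nat) (GH : erlc_coefs F u v T D).
Variable s : nat -> 'rV[F]_(u + v).

Definition erlc_pv (i : nat) : 'rV[F]_u :=
  \sum_(j < T.-1) delay j.+1 (fun t => rsubmx (s t)) i *m GH.1 j.

Definition erlc_pu (i : nat) : 'rV[F]_u :=
  \sum_(j < (T - D).+1) delay j (fun t => lsubmx (s t)) i *m GH.2 j.

End ERLC.

(* x[i] = (u[i], v[i], p_v[i] + p_u[i - D]) where s[i] = (u[i], v[i]). *)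
Definition erlc_encoder (F : finFieldType) (u v T D : nat)
    (GH : erlc_coefs F u v T D) : encoder F (u + v) (u + v + u) :=
  fun s i => row_mx (s i) (erlc_pv GH s i + delay D (erlc_pu GH s) i).

(* Uniform probability on a finite type. On [erlc_coefs] this is the law under
   which all matrix entries are independent and uniform on F. *)
Definition prob (Omega : finType) (E : pred Omega) : rat :=
  #|E|%:R / #|Omega|%:R.

(* A rate-1/2 convolutional code whose sum c_T + d_T is maximal among all
   rate-1/2 convolutional codes, over all finite fields. *)
Definition optimal_tradeoff (F : finFieldType) (k n : nat)
    (enc : encoder F k n) (T : nat) : Prop :=
  [/\ is_conv_encoder enc, rate k n = 1 / 2
    & forall (F' : finFieldType) (k' n' m' : nat)
             (A : 'I_m'.+1 -> 'M[F']_(k', n')),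
        rate k' n' = 1 / 2 ->
        (column_span (conv_encoder A) T + column_distance (conv_encoder A) T
           <= column_span enc T + column_distance enc T)%N].

(* Main.v *)
(** Upper bound: a source is recoverable from a channel that periodically erases
    c_T - 1 packets and then delivers T - d_T + 2, so the rate 1/2 is at most
    (T - d_T + 2) / (T - d_T + c_T + 1), that is, c_T + d_T <= T + 3.

    Lower bounds: rate 1/2 forces v = 0.  Put L = T - D.  As L < D, the times
    0..L carrying u[0..L] and the times D..T carrying p_u[0..L] are disjoint, so
    d_T >= L + 2 once no source with u[0] <> 0 has at most L + 1 nonzero packets
    among u[0..L], p_u[0..L].  For a fixed such source the p_u[i] are independent
    and uniform; hence for given supports the expected number of bad sources is at
    most 1, and since bad sources come in families of q - 1 multiples, a bad source
    exists with probability at most 4^(L+1) / (q - 1).  Otherwise u[0] <> 0 gives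
    p_u[0] <> 0, hence c_T >= D + 1, and the upper bound forces equality. *)

Require Import Defs.
From HB Require Import structures.
From mathcomp Require Import all_boot all_order all_algebra.
From mathcomp Require Import zify ring lra.

Set Implicit Arguments.
Unset Strict Implicit.
Unset Printing Implicit Defensive.

Import Order.TTheory GRing.Theory Num.Theory.
Local Open Scope ring_scope.

(** * Supports, weights and spans of packet sequences *)

Section Support.
Variables (V : nmodType) (T : nat) (x : nat -> V).

Lemma mem_support_times t : (t \in support_times T x) = (t <= T)%N && (x t != 0).
Proof. by rewrite mem_filter mem_iota /= add0n ltnS andbC. Qed.

Lemma support_times_uniq : uniq (support_times T x).
Proof. exact: filter_uniq (iota_uniq _ _). Qed.

Lemma support_times_bounds i r t :
  support_times T x = i :: r -> t \in support_times T x -> (i <= t <= last i r)%N.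
Proof.
move=> E tx; have srt : sorted leq (i :: r).
  by rewrite -E sorted_filter ?iota_sorted //; apply: leq_trans.
rewrite E in tx.
have le_nth := sorted_leq_nth leq_trans leqnn 0%N srt.
have lt_idx : (index t (i :: r) < size (i :: r))%N by rewrite index_mem.
rewrite -(nth_index 0%N tx) (last_nth 0%N).
apply/andP; split; last by apply: le_nth; rewrite ?inE.
by apply: (le_nth 0%N _ _ lt_idx).
Qed.

Lemma weight_le_span : (weight T x <= Defs.span T x)%N.
Proof.
rewrite /weight /Defs.span; case E: (support_times T x) => [//|i r].
have := support_times_uniq; rewrite E => ui.
rewrite -(size_iota i (last i r - i).+1); apply: uniq_leq_size => // t.
rewrite -E => /(support_times_bounds E); rewrite mem_iota => h; lia.
Qed.

Lemma span_le a b :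
  (forall t, (t <= T)%N -> x t != 0 -> (a <= t < b)%N) -> (Defs.span T x <= b - a)%N.
Proof.
move=> ab; rewrite /Defs.span; case E: (support_times T x) => [//|i r].
have in_ab t : t \in i :: r -> (a <= t < b)%N.
  by rewrite -E mem_support_times => /andP[]; apply: ab.
have hi : (a <= i < b)%N := in_ab _ (mem_head i r).
have hl : (a <= last i r < b)%N := in_ab _ (mem_last i r).
lia.
Qed.

Lemma span_gt d : (d <= T)%N -> x 0%N != 0 -> x d != 0 -> (d < Defs.span T x)%N.
Proof.
move=> dT x0 xd.
have s0 : 0%N \in support_times T x by rewrite mem_support_times x0.
have sd : d \in support_times T x by rewrite mem_support_times dT.
rewrite /Defs.span; case E: (support_times T x) s0 => [//|i r] _.
have := support_times_bounds E sd.
have : 0%N \in support_times T x by rewrite mem_support_times x0.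
move/(support_times_bounds E); lia.
Qed.

(** Serves windows whose possibly nonzero packets lie at both ends, where the span gives no useful
    bound. *)
Lemma weight_le_outside a b :
  (forall t, (t <= T)%N -> x t != 0 -> ((t < a) || (b <= t))%N) ->
  (weight T x <= a + (T.+1 - b))%N.
Proof.
move=> ab; rewrite /weight -{1}(size_iota 0 a) -(size_iota b (T.+1 - b)) -size_cat.
apply: uniq_leq_size; first exact: support_times_uniq.
move=> t; rewrite mem_support_times mem_cat !mem_iota => /andP[tT xt].
have := ab t tT xt; lia.
Qed.

Lemma weightE : weight T x = (\sum_(0 <= t < T.+1) (x t != 0)%R)%N.
Proof. by rewrite /weight size_filter -sum1_count big_mkcond /index_iota subn0. Qed.

End Support.

(** * Iterated minima, truncated sources and the rate *)

Section BigMin.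
Variables (I : finType) (P : pred I) (f : I -> nat) (m : nat).

Lemma bigminn_le i : P i -> (\big[minn/m]_(j | P j) f j <= f i)%N.
Proof.
move=> Pi; have : i \in index_enum I by rewrite mem_index_enum.
elim: (index_enum I) => [//|j r IH]; rewrite inE big_cons.
case/predU1P => [<-|/IH le_r]; first by rewrite Pi geq_minl.
by case: ifP => // _; apply: leq_trans (geq_minr _ _) le_r.
Qed.

Lemma bigminn_le_idx : (\big[minn/m]_(j | P j) f j <= m)%N.
Proof. by elim/big_rec: _ => // i y _; apply: leq_trans (geq_minr _ _). Qed.

Lemma bigminn_ge a :
  (a <= m)%N -> (forall i, P i -> (a <= f i)%N) -> (a <= \big[minn/m]_(j | P j) f j)%N.
Proof. by move=> am af; elim/big_rec: _ => // i y Pi ay; rewrite leq_min ay af. Qed.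

End BigMin.

Lemma extendE (V : nmodType) T (s : {ffun 'I_T.+1 -> V}) (i : 'I_T.+1) :
  extend s i = s i.
Proof. by rewrite /extend valK. Qed.

Lemma extend_out (V : nmodType) T (s : {ffun 'I_T.+1 -> V}) i :
  (T < i)%N -> extend s i = 0.
Proof. by move=> Ti; rewrite /extend insubF // ltnS leqNgt Ti. Qed.

Lemma extend_finfun (V : nmodType) T (x : nat -> V) i :
  (i <= T)%N -> extend [ffun j : 'I_T.+1 => x j] i = x i.
Proof.
move=> iT; have -> : i = Ordinal (n := T.+1) iT by [].
by rewrite extendE ffunE.
Qed.

Lemma column_distance_le_span (F : finFieldType) k n (enc : encoder F k n) T :
  (column_distance enc T <= column_span enc T)%N.
Proof.
apply: bigminn_ge; first exact: bigminn_le_idx.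
move=> s s0; apply: leq_trans (weight_le_span _ _).
exact: (bigminn_le (fun s => weight T (enc (extend s))) _ s0).
Qed.

Lemma rate_half k n : rate k n = 1 / 2 -> (0 < k)%N /\ n = (2 * k)%N.
Proof.
rewrite /rate => h.
(* Division by zero gives 0 in [rat], so rate 1/2 excludes [n = 0]. *)
have n0 : (n%:R : rat) != 0.
  by apply/eqP => n0; move: h; rewrite n0 invr0 mulr0 => /esym/eqP.
have e : (n%:R : rat) = (2 * k)%:R.
  rewrite natrM; have : (k%:R : rat) = n%:R * (1 / 2) by rewrite -h; field.
  lra.
move/eqP: e; rewrite eqr_nat => /eqP e; split => //.
by rewrite lt0n; apply/eqP => k0; move: n0; rewrite e k0.
Qed.

(** * The upper bound at rate 1/2 *)

Section ConvEncoder.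
Variables (F : finFieldType) (k n m : nat) (A : 'I_m.+1 -> 'M[F]_(k, n)).

Lemma conv_encoderB s1 s2 t :
  conv_encoder A (fun i => s1 i - s2 i) t = conv_encoder A s1 t - conv_encoder A s2 t.
Proof.
rewrite /conv_encoder -sumrB; apply: eq_bigr => j _.
by rewrite /delay; case: ifP => _; rewrite ?mulmxBl ?mul0mx ?subr0.
Qed.

(** Time invariance: with no packets before [i], the window starting at [i] is the beginning of an
    encoded source. Cutting the source after [T] is harmless by causality. *)
Lemma conv_encoder_shift T s i t :
  (forall l, (l < i)%N -> s l = 0) -> (t <= T)%N ->
  conv_encoder A (extend [ffun l : 'I_T.+1 => s (i + l)%N]) t =
  conv_encoder A s (i + t).
Proof.
move=> s0 tT; apply: eq_bigr => j _; congr (_ *m _); rewrite /delay.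
case: leqP => jt.
  by rewrite (extend_finfun (fun l => s (i + l)%N)) ?ifT ?addnBA; [| lia..].
by case: ifP => // ji; rewrite s0 //; lia.
Qed.

(* If the sum exceeded T + 3, every source could be recovered from the output of
   a channel which periodically erases c - 1 packets and then delivers T - d + 2:
   a source vanishing before time i has s[i] = 0 as soon as the window
   [i, i + T] of x is zero at the delivered times, since this window then
   has span < c or weight < d.  Over many periods this is impossible, because
   more than half of the packets are erased. *)
Lemma column_span_distance_le T :
  rate k n = 1 / 2 ->
  (column_span (conv_encoder A) T + column_distance (conv_encoder A) T <= T + 3)%N.
Proof.
case/rate_half => k_gt0 nk; rewrite leqNgt; apply/negP.
have := column_distance_le_span (conv_encoder A) T.
have := bigminn_le_idx (fun s : {ffun 'I_T.+1 -> 'rV[F]_k} => s ord0 != 0)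
  (fun s => Defs.span T (conv_encoder A (extend s))) T.+1.
have span_min := bigminn_le
  (fun s => Defs.span T (conv_encoder A (extend s))) T.+1
  (P := fun s : {ffun 'I_T.+1 -> 'rV[F]_k} => s ord0 != 0).
have weight_min := bigminn_le
  (fun s => weight T (conv_encoder A (extend s))) T.+1
  (P := fun s : {ffun 'I_T.+1 -> 'rV[F]_k} => s ord0 != 0).
rewrite -/(column_span (conv_encoder A) T) in span_min *.
rewrite -/(column_distance (conv_encoder A) T) in weight_min.
set c := column_span _ T in span_min *; set d := column_distance _ T in weight_min *.
move=> cT dc cd.
(* [W] packets are delivered per period [P], and [c + d > T + 3] gives [P >= 2W + 1]. [N] is chosen
   so that the [N + T + 1] observed periods deliver, in units of [k] symbols, 2W(N + T + 1) = N(2W +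
   1), which is less than the [K + 1] source packets. *)
pose W := (T + 2 - d)%N; pose P := (W + c.-1)%N.
pose N := (2 * W * T.+1)%N; pose K := (N * P)%N.
pose f (s : {ffun 'I_K.+1 -> 'rV[F]_k}) :=
  [ffun ab : 'I_(N + T.+1) * 'I_W =>
     conv_encoder A (extend s) (ab.1 * P + (c.-1 + ab.2))%N].
suff inj_f : injective f.
  have := leq_card f inj_f; rewrite !card_ffun !card_mx card_prod !card_ord !mul1n.
  rewrite -!expnM leq_exp2l ?card_finNzRing_gt1 // nk [(2 * k)%N]mulnC -mulnA.
  rewrite leq_pmul2l //.
  rewrite /K /N /P; nia.
move=> s1 s2 /ffunP eq_f; apply/eqP/negPn/negP => ne_s.
pose s i := extend s1 i - extend s2 i.
have exs : exists i, s i != 0.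
  have [i ne_i] : exists i, s1 i != s2 i.
    by apply/existsP; apply: contraNT ne_s => /existsPn h;
       apply/eqP/ffunP => i; apply/eqP/negPn/h.
  by exists i; rewrite /s !extendE subr_eq0.
(* [i] is the first time at which the two sources differ; the window at [i] will violate the
   minimality of [c] or [d]. *)
case: (ex_minnP exs) => i si min_i.
have s_lt l : (l < i)%N -> s l = 0.
  by move=> li; apply/eqP/negPn/negP => /min_i; rewrite leqNgt li.
have iK : (i <= K)%N.
  by rewrite leqNgt; apply: contra si => Ki; rewrite /s !extend_out // subrr.
have P_gt0 : (0 < P)%N by lia.
have recv0 t : (t <= K + T)%N -> (c.-1 <= t %% P)%N -> conv_encoder A s t = 0.
  move=> tK ct; rewrite conv_encoderB; apply/eqP; rewrite subr_eq0; apply/eqP.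
  have a_lt : (t %/ P < N + T.+1)%N by rewrite ltn_divLR // mulnDl /K in tK *; nia.
  have b_lt : (t %% P - c.-1 < W)%N by have := ltn_pmod t P_gt0; rewrite /P in ct *; lia.
  have := eq_f (Ordinal a_lt, Ordinal b_lt); rewrite !ffunE /=.
  by rewrite subnKC // -divn_eq.
pose s' := [ffun l : 'I_T.+1 => s (i + l)%N].
have s'0 : s' ord0 != 0 by rewrite ffunE addn0.
have win t : (t <= T)%N -> conv_encoder A (extend s') t != 0 ->
    ((i %% P + t) %% P < c.-1)%N.
  move=> tT; rewrite conv_encoder_shift // => xt; rewrite ltnNge modnDml.
  by apply: contra xt => ct; rewrite recv0 //; lia.
have := ltn_pmod i P_gt0; move: (i %% P)%N win => r win rP.
(* As P = T + 1 + (c - d), a window meets at most two periods. *)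
have wrap t : (t <= T)%N -> (P <= r + t)%N -> ((r + t) %% P = r + t - P)%N.
  move=> tT Prt; have {1}-> : (r + t = r + t - P + P)%N by lia.
  by rewrite modnDr modn_small //; lia.
have := span_min _ s'0; have := weight_min _ s'0; cbv beta.
(* For [r <= c - d] the window stays in one period, so its nonzero packets lie in a single erased
   block and the span is below [c]. *)
have [rc|rc] := leqP r (c - d).
  move=> _; apply/negP; rewrite -ltnNge.
  apply: (@leq_ltn_trans (c.-1 - 0)); last by lia.
  apply: span_le => t tT /(win _ tT); rewrite modn_small; lia.
(* Here the window starts among delivered packets and meets only the erased block of the next
   period: the span is again below [c]. *)
have [rc'|rc'] := leqP c.-1 r.
  move=> _; apply/negP; rewrite -ltnNge.
  apply: (@leq_ltn_trans ((P - r + c.-1) - (P - r))); last by lia.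
  apply: span_le => t tT /(win _ tT).
  have [rt|rt] := leqP P (r + t); first by rewrite wrap //; lia.
  by rewrite modn_small //; lia.
(* Otherwise two erased blocks are met, leaving at most (c - 1 - r) + (T + 1 - P + r) = d - 1
   nonzero packets. *)
move=> wd _; move: wd; apply/negP; rewrite -ltnNge.
apply: (@leq_ltn_trans ((c.-1 - r) + (T.+1 - (P - r)))); last by lia.
apply: weight_le_outside => t tT /(win _ tT).
have [rt|rt] := leqP P (r + t); first by lia.
by rewrite modn_small //; lia.
Qed.

End ConvEncoder.

(** * Counting the coefficients that admit a bad source *)

Section ToeplitzParity.
Variables (F : finFieldType) (u L : nat).
Local Notation coefs := {ffun 'I_L.+1 -> 'M[F]_u}.
Local Notation source := {ffun 'I_L.+1 -> 'rV[F]_u}.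
Implicit Types (H : coefs) (w y : source) (U P : {set 'I_L.+1}).

(** With L = T - D, this is [erlc_pu] expressed on the [u]-part of the source alone. *)
Definition parity H (s : nat -> 'rV[F]_u) (i : nat) : 'rV[F]_u :=
  \sum_(j < L.+1) delay j s i *m H j.

Lemma eq_parity H s s' i :
  (forall l, (l <= i)%N -> s l = s' l) -> parity H s i = parity H s' i.
Proof.
move=> ss'; apply: eq_bigr => j _; congr (_ *m _); rewrite /delay.
by case: ifP => // _; apply: ss'; apply: leq_subr.
Qed.

Lemma parity0 H s : parity H s 0 = s 0%N *m H ord0.
Proof.
by rewrite /parity big_ord_recl big1 ?addr0 // => j _; rewrite /delay /= mul0mx.
Qed.

Lemma parityD H H' s i : parity (H + H') s i = parity H s i + parity H' s i.
Proof. by rewrite -big_split; apply: eq_bigr => j _; rewrite ffunE mulmxDr. Qed.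

Lemma parityZ H a w i : parity H (extend (a *: w)) i = a *: parity H (extend w) i.
Proof.
rewrite scaler_sumr; apply: eq_bigr => j _; rewrite scalemxAl; congr (_ *m _).
rewrite /delay; case: ifP => _; last by rewrite scaler0.
by rewrite /extend; case: insubP => [l _ _|_]; rewrite ?ffunE ?scaler0.
Qed.

(* Take the coefficients of the form c h_l with s(0) c = 1: the h_l are then
   determined by a scalar unitriangular Toeplitz system. *)
Lemma parity_section (s : nat -> 'rV[F]_u) :
  s 0%N != 0 ->
  exists sigma : source -> coefs,
    forall y (i : 'I_L.+1), parity (sigma y) s i = y i.
Proof.
case/rV0Pn => j sj.
pose c : 'cV[F]_u := (s 0%N 0 j)^-1 *: delta_mx j 0.
have sc : (s 0%N *m c) 0 0 = 1.
  by rewrite -scalemxAr mxE -colE mxE mulVf.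
pose M : 'M[F]_L.+1 := \matrix_(i, l) (delay l s i *m c) 0 0.
have M_unit : M \in unitmx.
  rewrite unitmxE det_trig ?big1 ?unitr1 // => [i _|].
    by rewrite mxE /delay leqnn subnn.
  apply/is_trig_mxP => i l il; rewrite mxE /delay ifF ?mul0mx ?mxE //.
  by rewrite leqNgt il.
exists (fun y => [ffun l => c *m row l (invmx M *m \matrix_i y i)]) => y i.
rewrite -[RHS](rowK (fun i => y i)) -[in RHS](mulKVmx M_unit (\matrix_i y i)) row_mul.
rewrite mulmx_sum_row; apply: eq_bigr => l _.
by rewrite ffunE mulmxA [delay _ _ _ *m c]mx11_scalar mul_scalar_mx !mxE.
Qed.

Definition supported P y := [forall i, (i \notin P) ==> (y i == 0)].

Lemma supportedP P y : reflect (forall i, i \notin P -> y i = 0) (supported P y).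
Proof.
apply: (iffP forallP) => h i; last by apply/implyP => /h ->.
by move/implyP: (h i) => hi /hi /eqP.
Qed.

Lemma card_supported P : #|[set y | supported P y]| = (#|'rV[F]_u| ^ #|P|)%N.
Proof.
rewrite -(card_pffun_on 0 P predT) cardsE; apply: eq_card => y.
rewrite [LHS]inE; apply/supportedP/pffun_onP => [h | [/subsetP h _] i iP].
  split=> //; apply/subsetP => i; rewrite !inE.
  by apply: contraNT => /h ->.
by apply/eqP; apply: contraNT iP => yi; apply: h; rewrite inE.
Qed.

(** Adding [sigma y], with [y] supported off [P], to such an [H] is injective in the pair: off [P]
    the parity of the sum is [y], which then determines [H]. This is the counting form of the
    uniformity of the parities off [P]. *)
Lemma card_supported_parity P (s : nat -> 'rV[F]_u) :
  s 0%N != 0 ->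
  (#|[set H | supported P [ffun i : 'I_L.+1 => parity H s i]]| * #|'rV[F]_u| ^ #|~: P|
     <= #|coefs|)%N.
Proof.
case/parity_section => sigma sigmaE; rewrite -card_supported -cardsX.
set X := setX _ _.
have inj : {in X &, injective (fun Hy => Hy.1 + sigma Hy.2)}.
  move=> [H y] [H' y']; rewrite !inE /=.
  move=> /andP[/supportedP pH /supportedP yP] /andP[/supportedP pH' /supportedP yP'] e.
  have ey : y = y'.
    apply/ffunP => i; have := congr1 (fun H => parity H s i) e.
    rewrite !parityD !sigmaE; have [iP|iP] := boolP (i \in P).
      by rewrite yP ?yP' // inE iP.
    by have := pH _ iP; have := pH' _ iP; rewrite !ffunE => -> ->; rewrite !add0r.
  by rewrite ey in e *; rewrite (addIr _ e).
by rewrite -(card_in_imset inj) max_card.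
Qed.

Definition confined U P w H :=
  [&& w ord0 != 0, supported U w &
      supported P [ffun i : 'I_L.+1 => parity H (extend w) i]].

Lemma card_set_sum (I : finType) (p : pred I) : #|[set x | p x]| = (\sum_x p x)%N.
Proof. by rewrite -sum1dep_card big_mkcond; apply: eq_bigr => x _; case: (p x). Qed.

Lemma confinedZ U P w H a : a != 0 -> confined U P w H -> confined U P (a *: w) H.
Proof.
move=> a0 /and3P[w0 /supportedP wU /supportedP pP]; apply/and3P; split.
- by rewrite ffunE scaler_eq0 negb_or a0.
- by apply/supportedP => i iU; rewrite ffunE wU ?scaler0.
- apply/supportedP => i iP; rewrite ffunE parityZ.
  by have := pP i iP; rewrite ffunE => ->; rewrite scaler0.
Qed.

(* Union bound over the sources; since the nonzero multiples of a confined
   source are confined, it overcounts by a factor q - 1, which is the gain. *)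
Lemma card_confined U P :
  (#|U| + #|P| <= L.+1)%N ->
  (#|F|.-1 * #|[set H | [exists w, confined U P w H]]| <= #|coefs|)%N.
Proof.
move=> UP.
have Q_gt0 : (0 < #|'rV[F]_u| ^ #|~: P|)%N.
  by rewrite expn_gt0 card_mx expn_gt0 (ltnW (card_finNzRing_gt1 F)).
have lower : (#|F|.-1 * #|[set H | [exists w, confined U P w H]]|
    <= \sum_H #|[set w | confined U P w H]|)%N.
  rewrite card_set_sum big_distrr; apply: leq_sum => H _.
  case: existsP => [[w cw]|_] /=; last by rewrite muln0.
  rewrite muln1 -(cardC1 (0 : F)) -(card_imset _ (f := fun a => a *: w)).
    apply/subset_leq_card/subsetP => _ /imsetP[a a0 ->].
    by rewrite inE confinedZ.
  case/and3P: cw => w0 _ _ a b /ffunP/(_ ord0)/eqP.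
  by rewrite !ffunE -subr_eq0 -scalerBl scaler_eq0 (negPf w0) orbF subr_eq0 => /eqP.
(* Double counting, now source by source. The factor [Q_gt0] refers to clears the denominator, so
   each source contributes at most [#|coefs|]. *)
apply: leq_trans lower _; rewrite -(leq_pmul2r Q_gt0).
under eq_bigr do rewrite card_set_sum.
rewrite exchange_big big_distrl /=.
apply: (@leq_trans (\sum_(w | supported U w) #|coefs|)).
  rewrite [X in (_ <= X)%N]big_mkcond; apply: leq_sum => w _.
  rewrite -card_set_sum; case: ifPn => wU; last first.
    by rewrite (_ : [set _ | _] = set0) ?cards0 //; apply/setP => H;
       rewrite !inE /confined (negPf wU) andbF.
  have [w0|w0] := boolP (w ord0 != 0); last first.
    by rewrite (_ : [set _ | _] = set0) ?cards0 //; apply/setP => H;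
       rewrite !inE /confined (negPf w0).
  have := @card_supported_parity P (extend w).
  rewrite (extendE w ord0) => /(_ w0); apply: leq_trans.
  rewrite leq_mul2r; apply/orP; right; apply/subset_leq_card/subsetP => H.
  by rewrite !inE => /and3P[].
(* The hypothesis on sizes gives [#|U| <= #|~: P|], so the sources supported in [U] number at most
   the factor introduced. *)
rewrite sum_nat_const -[X in (X * _)%N]cardsE card_supported mulnC leq_mul2l.
apply/orP; right; rewrite leq_pexp2l //.
  by rewrite card_mx expn_gt0 (ltnW (card_finNzRing_gt1 F)).
by rewrite -(leq_add2r #|P|) [leqRHS]addnC cardsC card_ord.
Qed.

(** The sets only contain the supports and need not equal them, so any bad source is caught by some
    pair. *)
Definition degenerate H :=
  [exists UP : {set 'I_L.+1} * {set 'I_L.+1},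
     (#|UP.1| + #|UP.2| <= L.+1)%N && [exists w, confined UP.1 UP.2 w H]].

(** Union bound over the pairs of sets, with 2^(L+1) choices for each. *)
Lemma card_degenerate :
  (#|F|.-1 * #|[set H | degenerate H]| <= 4 ^ L.+1 * #|coefs|)%N.
Proof.
pose bad (UP : {set 'I_L.+1} * {set 'I_L.+1}) :=
  [set H | [exists w, confined UP.1 UP.2 w H]].
have le_sum : (#|[set H | degenerate H]|
    <= \sum_(UP : {set 'I_L.+1} * {set 'I_L.+1} | (#|UP.1| + #|UP.2| <= L.+1)%N) #|bad UP|)%N.
  rewrite card_set_sum; under [leqRHS]eq_bigr do rewrite card_set_sum.
  rewrite exchange_big; apply: leq_sum => H _.
  by have [/existsP[UP /andP[le_UP e]]|//] := boolP (degenerate H); rewrite (bigD1 UP) //= e.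
apply: leq_trans (leq_mul (leqnn _) le_sum) _.
rewrite big_distrr /=; apply: (@leq_trans (\sum_(UP : {set 'I_L.+1} * {set 'I_L.+1}) #|coefs|)).
  rewrite big_mkcond; apply: leq_sum => UP _.
  by case: ifP => // /card_confined.
by rewrite sum_nat_const card_prod -cardsT -powersetT card_powerset cardsT card_ord -expnMn.
Qed.

(* By nondegeneracy a nonzero s(0) has nonzero parity at time 0, as its at most
   1 + L nonzero packets would otherwise be too few. *)
Lemma parity0_neq0 H s : ~~ degenerate H -> s 0%N != 0 -> parity H s 0 != 0.
Proof.
move=> nH s0; apply: contra nH => /eqP p0.
pose w : source := [ffun i => if i == ord0 then s 0%N else 0].
apply/existsP; exists ([set ord0], ~: [set ord0]); rewrite cardsC card_ord leqnn /=.
apply/existsP; exists w; apply/and3P; split; first by rewrite ffunE.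
  by apply/supportedP => i; rewrite inE ffunE => /negPf ->.
apply/supportedP => i; rewrite !inE negbK ffunE => /eqP ->.
rewrite -p0 !parity0 (extendE w ord0) ffunE; done.
Qed.

(** Otherwise the exact supports of the source and of its parities up to time [L] would witness
    degeneracy; later source packets do not enter these parities. *)
Lemma nondegenerate_weight H s :
  ~~ degenerate H -> s 0%N != 0 ->
  (L.+2 <= \sum_(i < L.+1) (s i != 0)%R + \sum_(i < L.+1) (parity H s i != 0)%R)%N.
Proof.
move=> nH s0; rewrite ltnNge; apply: contra nH => le_w.
apply/existsP; exists ([set i : 'I_L.+1 | s i != 0], [set i : 'I_L.+1 | parity H s i != 0]).
rewrite !card_set_sum le_w /=; apply/existsP; exists [ffun i : 'I_L.+1 => s i].
apply/and3P; split; first by rewrite ffunE.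
  by apply/supportedP => i; rewrite inE negbK ffunE => /eqP.
apply/supportedP => i; rewrite inE negbK ffunE => /eqP <-; apply: eq_parity => l li.
by rewrite extend_finfun //; apply: leq_trans li _; rewrite -ltnS.
Qed.

End ToeplitzParity.

(** * Embedded codes as convolutional codes *)

Section EmbeddedRandomCode.
Variable F : finFieldType.

Lemma sum_row_mx (I : finType) p q r (a : I -> 'M[F]_(p, q)) (b : I -> 'M[F]_(p, r)) :
  \sum_i row_mx (a i) (b i) = row_mx (\sum_i a i) (\sum_i b i).
Proof.
apply/esym; apply: (big_rec3 (fun x y z => row_mx x y = z)); first exact: row_mx0.
by move=> i x y _ _ <-; rewrite add_row_mx.
Qed.

Lemma delay_morph (V W : nmodType) (f : V -> W) j x i :
  f 0 = 0 -> f (delay j x i) = delay j (fun t => f (x t)) i.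
Proof. by rewrite /delay; case: ifP. Qed.

(** Makes a finite family of coefficients total, so that [delay] can place it at any offset. *)
Definition zero_pad (V : nmodType) N (g : 'I_N -> V) (j : nat) : V :=
  oapp g 0 (insub j).

(** Brings filters of different lengths and offsets to the common memory [T]: the added coefficients
    vanish, and reindexing moves the offset [e] onto the source. *)
Lemma sum_delay_zero_pad p r N e T (x : nat -> 'rV[F]_p) (g : 'I_N -> 'M[F]_(p, r)) i :
  (N + e <= T.+1)%N ->
  \sum_(j < T.+1) delay j x i *m delay e (zero_pad g) j =
  \sum_(j < N) delay (e + j) x i *m g j.
Proof.
move=> NeT.
rewrite -(big_mkord xpredT (fun j => delay j x i *m delay e (zero_pad g) j)).
rewrite (@big_cat_nat _ _ _ e) //=; last by lia.
rewrite big_nat_cond big1 ?add0r; last first.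
  by move=> j /andP[/andP[_ je] _]; rewrite /delay [(e <= j)%N]leqNgt je mulmx0.
rewrite -{1}[e]add0n big_addn (@big_cat_nat _ _ _ N) //=; last by lia.
rewrite addrC big_nat_cond big1 ?add0r; last first.
  move=> j /andP[/andP[Nj _] _]; rewrite /delay leq_addl addnK /zero_pad insubF ?mulmx0 //.
  by rewrite ltnNge Nj.
rewrite big_mkord; apply: eq_bigr => j _.
by rewrite [delay e _ _]/delay leq_addl addnK /zero_pad valK addnC.
Qed.

Lemma erlc_is_conv u v T D (GH : erlc_coefs F u v T D) :
  (D <= T)%N -> is_conv_encoder (erlc_encoder GH).
Proof.
move=> DT; exists T.
(* [A_j] is the identity (for j = 0) or zero, beside H_(j-D) stacked on G_j. The offset 1 appears
   because G_j is stored at index j - 1. *)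
exists (fun j => row_mx (if j == ord0 then 1%:M else 0)
  (col_mx (delay D (zero_pad GH.2) j) (delay 1 (zero_pad GH.1) j))) => s i.
rewrite /conv_encoder; under eq_bigr do
  rewrite mul_mx_row -[X in X *m col_mx _ _]hsubmxK mul_row_col.
rewrite sum_row_mx big_split /=; congr row_mx.
  rewrite big_ord_recl big1 ?addr0 => [|j _]; last by rewrite mulmx0.
  by rewrite mulmx1 /delay /= subn0.
rewrite addrC; congr (_ + _).
  under [RHS]eq_bigr do rewrite (delay_morph (f := @rsubmx F 1 u v) _ _ _ (raddf0 _)).
  by rewrite sum_delay_zero_pad //; lia.
under [RHS]eq_bigr do rewrite (delay_morph (f := @lsubmx F 1 u v) _ _ _ (raddf0 _)).
rewrite sum_delay_zero_pad; last by lia.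
rewrite /delay /erlc_pu; case: leqP => Di; last first.
  by rewrite big1 // => j _; rewrite ifF ?mul0mx //; lia.
by apply: eq_bigr => j _; rewrite /delay leq_subRL // subnDA.
Qed.

Lemma conv_encoder_bound k n (enc : encoder F k n) T :
  is_conv_encoder enc -> rate k n = 1 / 2 ->
  (column_span enc T + column_distance enc T <= T + 3)%N.
Proof.
case=> m [A encE] kn; apply: leq_trans (column_span_distance_le A T kn).
have eqs s : support_times T (enc s) = support_times T (conv_encoder A s).
  by apply: eq_filter => t; rewrite encE.
apply: leq_add; apply: eq_leq; apply: eq_bigr => s _.
  by rewrite /Defs.span eqs.
by rewrite /weight eqs.
Qed.

(** * Lower bounds for nondegenerate coefficients at rate 1/2 *)

Section RateHalf.
Variables (u T D : nat) (GH : erlc_coefs F u 0 T D).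
Hypotheses (TD : (T.+1 <= 2 * D)%N) (DT : (D <= T)%N).
Hypothesis nGH : ~~ degenerate GH.2.
Variable s : nat -> 'rV[F]_(u + 0).
Hypothesis s0 : s 0%N != 0.
(** Source packets have type ['rV[F]_(u + 0)]; [w] drops their empty [v]-part. *)
Let w i := lsubmx (s i).

Let lsub_neq0 i : (w i != 0) = (s i != 0).
Proof. by rewrite -[s i]hsubmxK row_mx_eq0 [rsubmx _]thinmx0 eqxx andbT. Qed.

Lemma erlc_neq0 i :
  (erlc_encoder GH s i != 0) = (w i != 0) || (delay D (parity GH.2 w) i != 0).
Proof.
rewrite row_mx_eq0 negb_and lsub_neq0 /erlc_pv big1 ?add0r // => j _.
by rewrite [delay _ _ _]thinmx0 mul0mx.
Qed.

Lemma erlc_weight_ge : (T - D + 2 <= weight T (erlc_encoder GH s))%N.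
Proof.
have w0 : w 0%N != 0 by rewrite lsub_neq0.
have := nondegenerate_weight nGH w0; rewrite addn2 => h; apply: leq_trans h _.
(* The times 0..T-D count the source packets, the times D..T the parities; [T.+1 <= 2 * D] keeps the
   two blocks disjoint. *)
rewrite weightE (@big_cat_nat _ _ _ (T - D).+1) //=; last by lia.
apply: leq_add.
  by rewrite big_mkord; apply: leq_sum => i _; rewrite erlc_neq0; case: (w i != 0).
rewrite (@big_cat_nat _ _ _ D) //=; [|lia..].
apply: leq_trans (leq_addl _ _).
rewrite -[X in (_ <= \sum_(X <= _ < _) _)%N]add0n big_addn subSn // big_mkord; apply: leq_sum => i _.
by rewrite erlc_neq0 [delay _ _ _]/delay leq_addl addnK; case: (parity _ _ _ != 0); rewrite ?orbT.
Qed.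

Lemma erlc_span_ge : (D < Defs.span T (erlc_encoder GH s))%N.
Proof.
have w0 : w 0%N != 0 by rewrite lsub_neq0.
apply: span_gt => //; rewrite erlc_neq0 ?w0 //.
by rewrite [delay _ _ _]/delay leqnn subnn parity0_neq0 // orbT.
Qed.

End RateHalf.

Lemma erlc_span_distance u T D (GH : erlc_coefs F u 0 T D) :
  (T.+1 <= 2 * D)%N -> (D <= T)%N -> rate (u + 0) (u + 0 + u) = 1 / 2 ->
  ~~ degenerate GH.2 ->
  column_span (erlc_encoder GH) T = D.+1 /\
  column_distance (erlc_encoder GH) T = (T - D + 2)%N.
Proof.
move=> TD DT R nGH.
have := conv_encoder_bound T (erlc_is_conv GH DT) R.
have : (D.+1 <= column_span (erlc_encoder GH) T)%N.
  apply: bigminn_ge => // s s0; apply: erlc_span_ge => //.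
  by rewrite (extendE s ord0).
have : (T - D + 2 <= column_distance (erlc_encoder GH) T)%N.
  apply: bigminn_ge => [|s s0]; first by lia.
  by apply: erlc_weight_ge => //; rewrite (extendE s ord0).
lia.
Qed.

End EmbeddedRandomCode.

(** * From counting to probability, and the theorem *)

(** Degeneracy depends only on the second component of [erlc_coefs], so the first factor cancels. *)
Lemma prob_le_prod (A B : finType) (P : pred B) (a b : nat) :
  (0 < #|A|)%N -> (0 < #|B|)%N -> (0 < a)%N ->
  (a * #|[set y | P y]| <= b * #|B|)%N ->
  prob (fun xy : A * B => P xy.2) <= b%:R / a%:R.
Proof.
move=> A0 B0 a0 le_ab; rewrite /prob card_prod.
have -> : #|(fun xy : A * B => P xy.2)| = (#|A| * #|[set y | P y]|)%N.
  rewrite -cardsT -cardsX -[LHS]cardsE; apply: eq_card => xy.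
  by rewrite !inE.
rewrite ler_pdivrMr ?ltr0n ?muln_gt0 ?A0 //.
rewrite mulrAC ler_pdivlMr ?ltr0n // -!natrM ler_nat.
by rewrite -mulnA [X in (_ <= X)%N]mulnCA leq_mul2l mulnC le_ab orbT.
Qed.

Lemma prob_compl (Omega : finType) (B E : pred Omega) :
  (0 < #|Omega|)%N -> (forall x, ~~ B x -> E x) -> 1 - prob B <= prob E.
Proof.
move=> O0 BE; rewrite lerBlDr /prob -mulrDl ler_pdivlMr ?ltr0n // mul1r.
rewrite -natrD ler_nat -(cardC B) addnC leq_add2r.
by apply/subset_leq_card/subsetP => x /BE.
Qed.

Theorem mainTheorem4 (T u v D : nat) (hT : (1 <= T)%N) (hu : (1 <= u)%N)
    (hD : (T.+1 <= 2 * D)%N) (hDT : (D <= T)%N)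
    (hR : rate (u + v) (u + v + u) = 1 / 2) :
  [/\ (* with probability tending to 1 as q = #|F| tends to infinity *)
      forall eps : rat, 0 < eps ->
        exists q0 : nat, forall F : finFieldType, (q0 <= #|F|)%N ->
          1 - eps <=
            prob (fun GH : erlc_coefs F u v T D =>
              [&& column_span (erlc_encoder GH) T == D.+1,
                  column_distance (erlc_encoder GH) T == (T - D + 2)%N
                & column_span (erlc_encoder GH) T
                    + column_distance (erlc_encoder GH) T == T + 3]%N),
      (* the upper bound for every convolutional code of rate 1/2 *)
      forall (F : finFieldType) (k n m : nat) (A : 'I_m.+1 -> 'M[F]_(k, n)),
        rate k n = 1 / 2 ->
        (column_span (conv_encoder A) T + column_distance (conv_encoder A) T
           <= T + 3)%N
    & (* codes meeting it are optimal *)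
      forall (F : finFieldType) (GH : erlc_coefs F u v T D),
        is_conv_encoder (erlc_encoder GH)
        /\ (column_span (erlc_encoder GH) T = D.+1 ->
            column_distance (erlc_encoder GH) T = (T - D + 2)%N ->
            optimal_tradeoff (erlc_encoder GH) T)].
Proof.
have v0 : v = 0%N by case: (rate_half hR); lia.
subst v; split; last first.
- move=> F GH; have conv := erlc_is_conv GH hDT; split=> // cE dE.
  split=> // F' k' n' m' A R; apply: leq_trans (column_span_distance_le A T R) _.
  by rewrite cE dE; lia.
- by move=> F k n m A; apply: column_span_distance_le.
move=> eps eps0; pose C := (4 ^ (T - D).+1)%N.
(* This makes q - 1 exceed C / eps, hence the failure probability, at most C / (q - 1), is below
   [eps]. *)
exists (Num.bound (C%:R / eps)).+2 => F qF.
have q1 : (0 < #|F|.-1)%N by have := card_finNzRing_gt1 F; lia.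
have card_pos (I : finType) p r : (0 < #|{ffun I -> 'M[F]_(p, r)}|)%N.
  by apply/card_gt0P; exists [ffun=> 0].
have dg := card_degenerate F u (T - D).
have := prob_le_prod (card_pos 'I_T.-1 0%N u) (card_pos _ _ _) q1 dg.
set B := (X in prob X <= _) => pB.
apply: le_trans (_ : 1 - prob B <= _).
  rewrite lerD2l lerN2; apply: le_trans pB _.
  rewrite ler_pdivrMr ?ltr0n // mulrC -ler_pdivrMr //; apply: ltW.
  have Ceps : 0 <= C%:R / eps by rewrite divr_ge0 ?ler0n ?ltW.
  by apply: lt_le_trans (archi_boundP Ceps) _; rewrite ler_nat; lia.
apply: prob_compl; first by rewrite card_prod muln_gt0 !card_pos.
move=> GH nB; have [-> ->] := erlc_span_distance hD hDT hR nB.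
by rewrite !eqxx /=; apply/eqP; lia.
Qed.
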